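(* Let $X$ be a hilbertizable Fréchet-Schwartz space. Then $\Delta(X)=\Delta_b(X)=\Delta^\infty(X)=\Delta_b^\infty(X)$. In particular, these equalities hold for every nuclear Fréchet space $X$.
   Context: Let $X$ be a locally convex space (over $\mathbb{R}$ or $\mathbb{C}$), $\mathscr{U}_0(X)$ the system of absolutely convex $0$-neighbourhoods of $X$, and $\mathscr{B}(X)$ the system of all bounded subsets of $X$. For $n\in\mathbb{N}_0$, $V\subseteq X$ and an absolutely convex set $U\subseteq X$, the $n$-th Kolmogorov width is $\delta_n(V,U)=\inf\{\delta>0: V\subseteq \delta U+L$ for an at most $n$-dimensional linear subspace $L$ of $X\}$ (with $\inf\emptyset=+\infty$). Define the following sets of real sequences: $\Delta(X)=\{(\xi_n)_{n\in\mathbb{N}_0}\in\mathbb{R}^{\mathbb{N}_0}: \forall U\in\mathscr{U}_0(X)\ \exists V\in\mathscr{U}_0(X) \text{ with } \xi_n\delta_n(V,U)\to 0\}$; $\Delta_b(X)=\{\xi\in\mathbb{R}^{\mathbb{N}_0}: \forall U\in\mathscr{U}_0(X)\ \forall B\in\mathscr{B}(X):\ \xi_n\delta_n(B,U)\to 0\}$; $\Delta^\infty(X)=\{\xi\in\mathbb{R}^{\mathbb{N}_0}: \forall U\in\mathscr{U}_0(X)\ \exists V\in\mathscr{U}_0(X) \text{ with } (\xi_n\delta_n(V,U))_n \text{ bounded}\}$; $\Delta_b^\infty(X)=\{\xi\in\mathbb{R}^{\mathbb{N}_0}: \forall U\in\mathscr{U}_0(X)\ \forall B\in\mathscr{B}(X):\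 (\xi_n\delta_n(B,U))_n \text{ is bounded}\}$. $X$ is a Schwartz space if every $U\in\mathscr{U}_0(X)$ contains some $V\in\mathscr{U}_0(X)$ which is precompact with respect to the Minkowski functional of $U$. A Fréchet-Schwartz space is a Fréchet space which is a Schwartz space. $X$ is hilbertizable if its topology is given by a system of seminorms each induced by a (semi-)scalar product. *)

(* Defs.v *)
From HB Require Import structures.
From mathcomp Require Import all_boot all_order all_algebra.
From mathcomp Require Import complex.
From mathcomp Require Import all_classical all_reals all_analysis.

Set Implicit Arguments.
Unset Strict Implicit.
Unset Printing Implicit Defensive.

Import Order.TTheory GRing.Theory Num.Theory.
Import numFieldNormedType.Exports.

Local Open Scope classical_set_scope.
Local Open Scope ring_scope.

(* The scalar field is either R or R[i]. All analytic quantities (seminorms,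
   widths, radii) take values in R, and are compared with elements of the scalar
   field through [of_real]. *)
Variant scalar_kind := RealScalars | ComplexScalars.

Definition scalars (R : realType) (k : scalar_kind) : numFieldType :=
  match k with
  | RealScalars => R
  | ComplexScalars => R[i]
  end.

Definition of_real (R : realType) (k : scalar_kind) : R -> scalars R k :=
  match k return R -> scalars R k with
  | RealScalars => fun r => r
  | ComplexScalars => fun r => r%:C%C
  end.
Arguments of_real {R} k r.

Definition scalar_conj (R : realType) (k : scalar_kind) :
    scalars R k -> scalars R k :=
  match k return scalars R k -> scalars R k with
  | RealScalars => fun a => a
  | ComplexScalars => fun a => a^*%C
  end.
Arguments scalar_conj {R} k a.

Section LocallyConvexSpace.
Context {R : realType} {k : scalar_kind} (X : tvsType (scalars R k)).
Local Notation K := (scalars R k).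

Definition dilate (t : R) (U : set X) : set X := [set of_real k t *: u | u in U].

Definition absolutely_convex (U : set X) : Prop :=
  forall (a b : K) (x y : X),
    `|a| + `|b| <= 1 -> U x -> U y -> U (a *: x + b *: y).

Definition zero_nbhds : set (set X) :=
  [set U | nbhs (0 : X) U /\ absolutely_convex U].

Definition bounded_sets : set (set X) :=
  [set B | forall U : set X, nbhs (0 : X) U ->
     exists r : R, 0 < r /\ B `<=` dilate r U].

Definition dim_at_most (n : nat) (L : set X) : Prop :=
  exists v : 'I_n -> X,
    L = [set x | exists c : 'I_n -> K, x = \sum_(i < n) c i *: v i].

(* Valued in the extended reals: the infimum of the empty set is +oo. *)
Definition kolmogorov_width (n : nat) (V U : set X) : \bar R :=
  ereal_inf [set d%:E | d in [set d : R | 0 < d /\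
    exists L : set X, dim_at_most n L /\
      V `<=` [set u + l | u in dilate d U & l in L]]].

Local Notation delta := kolmogorov_width.

Definition Delta : set (nat -> R) :=
  [set xi | forall U, zero_nbhds U -> exists V, zero_nbhds V /\
    ((xi n)%:E * delta n V U)%E @[n --> \oo] --> 0%E].

Definition Delta_b : set (nat -> R) :=
  [set xi | forall U, zero_nbhds U -> forall B, bounded_sets B ->
    ((xi n)%:E * delta n B U)%E @[n --> \oo] --> 0%E].

Definition Delta_infty : set (nat -> R) :=
  [set xi | forall U, zero_nbhds U -> exists V, zero_nbhds V /\
    exists M : R, forall n, (`|(xi n)%:E * delta n V U| <= M%:E)%E].

Definition Delta_b_infty : set (nat -> R) :=
  [set xi | forall U, zero_nbhds U -> forall B, bounded_sets B ->
    exists M : R, forall n, (`|(xi n)%:E * delta n B U| <= M%:E)%E].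

Definition minkowski_functional (U : set X) (x : X) : R :=
  inf [set t : R | 0 < t /\ dilate t U x].

Local Notation gauge := minkowski_functional.

Definition precompact_wrt (p : X -> R) (V : set X) : Prop :=
  forall e : R, 0 < e ->
    exists F : set X, finite_set F /\
      forall v, V v -> exists x, F x /\ p (v - x) < e.

Definition schwartz_space : Prop :=
  forall U, zero_nbhds U ->
    exists V, [/\ zero_nbhds V, V `<=` U & precompact_wrt (gauge U) V].

Definition metrizable : Prop :=
  exists d : X -> X -> R,
    [/\ forall x y, 0 <= d x y,
        forall x y, d x y = 0 <-> x = y,
        forall x y, d x y = d y x,
        forall x y z, d x z <= d x y + d y z &
        forall (x : X) (A : set X), nbhs x A <->
          exists e : R, 0 < e /\ [set y | d x y < e] `<=` A].

(* [tvsType] does not relate the uniform structure it carries to the addition,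
   hence Cauchy filters are those of the canonical (translation-invariant)
   uniformity, not those of the library's [cauchy]. *)
Definition cauchy_filter (F : set_system X) : Prop :=
  forall U : set X, nbhs (0 : X) U ->
    exists A, F A /\ forall x y, A x -> A y -> U (x - y).

Definition complete_space : Prop :=
  forall F : set_system X, ProperFilter F -> cauchy_filter F ->
    exists x : X, F --> x.

Definition frechet_space : Prop := metrizable /\ complete_space.

Definition semi_scalar_product (s : X -> X -> K) : Prop :=
  [/\ forall (a : K) (x y z : X), s (a *: x + y) z = a * s x z + s y z,
      forall x y, s y x = scalar_conj k (s x y) &
      forall x, 0 <= s x x].

Definition seminorm_induced_by (p : X -> R) (s : X -> X -> K) : Prop :=
  forall x, 0 <= p x /\ of_real k (p x ^+ 2) = s x x.

Definition topology_given_by (P : set (X -> R)) : Prop :=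
  forall (x : X) (A : set X), nbhs x A <->
    exists F : set (X -> R), [/\ finite_set F, F `<=` P &
      exists e : R, 0 < e /\ [set y | forall p, F p -> p (y - x) < e] `<=` A].

Definition hilbertizable : Prop :=
  exists P : set (X -> R), topology_given_by P /\
    forall p, P p ->
      exists s, semi_scalar_product s /\ seminorm_induced_by p s.

(* Nuclearity of the canonical map from (X, gauge V) to (X, gauge U), i.e. of the
   map between the associated normed spaces: x = \sum_n f_n(x) y_n with
   \sum_n |f_n|_V' |y_n|_U finite, c n being a bound for the dual norm of f_n. *)
Definition nuclear_canonical_map (V U : set X) : Prop :=
  exists (f : nat -> {linear X -> K^o}) (y : nat -> X) (c : nat -> R),
    [/\ forall n, 0 <= c n,
        forall n x, `|f n x| <= of_real k (c n * gauge V x) :> K,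
        cvgn (series (fun n => c n * gauge U (y n))) &
        forall x, gauge U (x - \sum_(i < n) (f i x : K) *: y i)
          @[n --> \oo] --> (0 : R)].

Definition nuclear_space : Prop :=
  forall U, zero_nbhds U ->
    exists V, [/\ zero_nbhds V, V `<=` U & nuclear_canonical_map V U].

End LocallyConvexSpace.

(* Main.v *)
(** The inclusions [Delta <= Delta_b <= Delta_b_infty] are immediate, so it
    suffices to show [Delta_b_infty <= Delta_infty <= Delta].

    For the first one let [U] be such that [xi_n delta_n(V, U)] is unbounded
    for every [V]. A precompact [V] contains a finite set whose [n]-th width is
    almost that of [V]; choosing such finite sets in the members of a countable
    basis of 0-neighbourhoods, their union is bounded and witnesses that [xi]
    is not in [Delta_b_infty].

    For the second one take [V] in [U], precompact with respect to [U], which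
    is the unit ball of a hilbertian seminorm [p], and let [W] be a
    0-neighbourhood with [W <= d V + L]. Nearly best approximation from [L]
    gives [w = l + d v] with [v] in [V] nearly [p]-orthogonal to [L]. When [d]
    is small, [L] comes [p]-close to any given finite subset of [X], so that
    [v] is nearly orthogonal to such a set, and precompactness of [V] forces
    [v] into [e U]. Hence [delta_n(W, U) <= e delta_n(W, V)] for large [n].

    In a nuclear space, with [x = sum_i f_i(x) y_i], the hilbertian seminorms
    are given by weighted sums of [|f_i(x)|^2]. *)

Require Import Defs.
From HB Require Import structures.
From mathcomp Require Import all_boot all_order all_algebra.
From mathcomp Require Import complex.
From mathcomp Require Import all_classical all_reals all_analysis.
From mathcomp Require Import ring lra.

Set Implicit Arguments.
Unset Strict Implicit.
Unset Printing Implicit Defensive.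

Import Order.TTheory GRing.Theory Num.Theory.
Import numFieldNormedType.Exports.

Local Open Scope classical_set_scope.
Local Open Scope ring_scope.

(** * Real and complex scalars treated uniformly *)

Section Scalars.
Context {R : realType} {k : scalar_kind}.
Local Notation K := (scalars R k).
Local Notation ofR := (of_real (R := R) k).

Lemma of_real_is_zmod_morphism : {morph ofR : x y / x - y}.
Proof. by case: k => //= x y; rewrite rmorphB. Qed.

Lemma of_real_is_monoid_morphism : (ofR 1 = 1) * {morph ofR : x y / x * y}.
Proof. by case: k; split => //= x y; rewrite rmorphM. Qed.

HB.instance Definition _ :=
  GRing.isZmodMorphism.Build R K ofR of_real_is_zmod_morphism.
HB.instance Definition _ :=
  GRing.isMonoidMorphism.Build R K ofR of_real_is_monoid_morphism.

Lemma ler_of_real (s t : R) : (ofR s <= ofR t) = (s <= t).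
Proof. by case: k => //=; rewrite lecR. Qed.

Lemma ltr_of_real (s t : R) : (ofR s < ofR t) = (s < t).
Proof. by case: k => //=; rewrite ltcR. Qed.

Lemma of_real_inj : injective ofR.
Proof. by move=> s t /eqP; rewrite eq_le !ler_of_real -eq_le => /eqP. Qed.

(** In the order of [R[i]] only real numbers are comparable with 0. *)
Lemma gt0_of_realP (e : K) : 0 < e -> exists2 t, 0 < t & e = ofR t.
Proof.
case: k e => /= [e e0|e e0]; first by exists e.
have /complex_realP[t et] : e \is Num.real by rewrite gtr0_real.
by exists t => //; rewrite -ltcR -et.
Qed.

Lemma norm_of_realP (a : K) : exists2 t, 0 <= t & `|a| = ofR t.
Proof.
have [->|a0] := eqVneq a 0; first by exists 0; rewrite // normr0 rmorph0.
have /gt0_of_realP[t t0 ->] : 0 < `|a| by rewrite normr_gt0.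
by exists t => //; exact: ltW.
Qed.

(** The norm of [K] takes its values in [K]; seminorms and radii need it in [R]. *)
Definition modulus (a : K) : R := sval (cid2 (norm_of_realP a)).

Lemma modulus_ge0 a : 0 <= modulus a.
Proof. by rewrite /modulus; case: cid2. Qed.

Lemma modulusE a : `|a| = ofR (modulus a).
Proof. by rewrite /modulus; case: cid2. Qed.

Lemma modulus_of_real t : modulus (ofR t) = `|t|.
Proof.
apply: of_real_inj; rewrite -modulusE.
by case: k => //=; rewrite normc_def /= expr0n addr0 sqrtr_sqr.
Qed.

Lemma norm_of_real t : `|ofR t| = ofR `|t|.
Proof. by rewrite modulusE modulus_of_real. Qed.

Lemma modulus0 : modulus 0 = 0.
Proof. by apply: of_real_inj; rewrite -modulusE normr0 rmorph0. Qed.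

Definition re_part : K -> R :=
  match k return scalars R k -> R with
  | RealScalars => fun a => a
  | ComplexScalars => fun a => complex.Re a
  end.

Lemma re_partD a b : re_part (a + b) = re_part a + re_part b.
Proof. by rewrite /re_part; case: k a b => // -[a ?] [b ?]. Qed.

Lemma re_partZ t a : re_part (ofR t * a) = t * re_part a.
Proof. by rewrite /re_part; case: k a => // -[a ?] /=; rewrite mul0r subr0. Qed.

Lemma re_part_of_real t : re_part (ofR t) = t.
Proof. by rewrite /re_part; case: k. Qed.

Lemma re_part_conj (a : K) : re_part (scalar_conj k a) = re_part a.
Proof. by rewrite /re_part; case: k a => // -[]. Qed.

Lemma scalar_conjM (a b : K) :
  scalar_conj k (a * b) = scalar_conj k a * scalar_conj k b.
Proof. by case: k a b => //= a b; rewrite rmorphM. Qed.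

Lemma mul_scalar_conj (a : K) : a * scalar_conj k a = ofR (modulus a ^+ 2).
Proof.
rewrite rmorphXn /= -modulusE; case: k a => /= a; last by rewrite sqr_normc.
by rewrite real_normK ?num_real.
Qed.

End Scalars.

(** * Dilations and absolutely convex neighbourhoods of zero *)

Section AbsolutelyConvex.
Context {R : realType} {k : scalar_kind} {X : tvsType (scalars R k)}.
Local Notation K := (scalars R k).
Local Notation ofR := (of_real (R := R) k).
Implicit Types (U V A : set X) (x y : X) (s t : R).

Lemma scale_of_realK t x : t != 0 -> ofR t *: (ofR t^-1 *: x) = x.
Proof. by move=> t0; rewrite scalerA -rmorphM mulfV// rmorph1 scale1r. Qed.

Lemma dilateP t U x : t != 0 -> dilate t U x <-> U (ofR t^-1 *: x).
Proof.
move=> t0; split; last by exists (ofR t^-1 *: x) => //; exact: scale_of_realK.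
by move=> [u Uu <-]; rewrite scalerA -rmorphM mulVf// rmorph1 scale1r.
Qed.

Lemma dilateS t U V : U `<=` V -> dilate t U `<=` dilate t V.
Proof. exact: image_subset. Qed.

Lemma dilate1 U : dilate 1 U = U.
Proof.
apply/seteqP; split => [_ [u Uu <-]|u Uu]; first by rewrite rmorph1 scale1r.
by exists u => //; rewrite rmorph1 scale1r.
Qed.

Lemma dilateM s t U : dilate s (dilate t U) = dilate (s * t) U.
Proof.
apply/seteqP; split => [_ [_ [u Uu <-] <-]|_ [u Uu <-]].
  by exists u => //; rewrite scalerA rmorphM.
by exists (ofR t *: u); [exists u|rewrite scalerA rmorphM].
Qed.

Lemma absolutely_convex0 U x : absolutely_convex U -> U x -> U 0.
Proof.
move=> acU Ux; have := acU 0 0 x x; rewrite !scale0r addr0; apply => //.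
by rewrite normr0 addr0 ler01.
Qed.

Lemma absolutely_convexZ U a x : absolutely_convex U -> `|a| <= 1 -> U x ->
  U (a *: x).
Proof.
move=> acU a1 Ux; have := acU a 0 x x.
by rewrite normr0 addr0 scale0r addr0; exact.
Qed.

Lemma dilateZ U a s x : absolutely_convex U -> 0 <= s -> dilate s U x ->
  dilate (modulus a * s) U (a *: x).
Proof.
move=> acU s0 [u Uu <-].
have [->|a0] := eqVneq a 0.
  rewrite modulus0 mul0r scale0r; exists u => //.
  by rewrite rmorph0 scale0r.
exists ((a / `|a|) *: u).
  apply: absolutely_convexZ => //.
  by rewrite normf_div normr_id divff// normr_eq0.
rewrite !scalerA rmorphM /= -modulusE mulrAC mulrCA divff ?normr_eq0//.
by rewrite mulr1.
Qed.

Lemma dilateN U s x : absolutely_convex U -> 0 <= s -> dilate s U x ->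
  dilate s U (- x).
Proof.
move=> acU s0 /(dilateZ (-1) acU s0).
by rewrite scaleN1r -(rmorph1 ofR) -rmorphN modulus_of_real normrN1 mul1r.
Qed.

Lemma dilateD U s t x y : absolutely_convex U -> 0 <= s -> 0 <= t ->
  dilate s U x -> dilate t U y -> dilate (s + t) U (x + y).
Proof.
move=> acU s0 t0 [u Uu <-] [v Uv <-].
(* This case is treated apart because [s + t] is divided by below. *)
have [->|s_neq0] := eqVneq s 0.
  by rewrite rmorph0 scale0r !add0r; exists v.
have st0 : 0 < s + t by rewrite ltr_pwDl// lt_neqAle eq_sym s_neq0.
exists (ofR (s / (s + t)) *: u + ofR (t / (s + t)) *: v).
  apply: acU => //.
  rewrite !norm_of_real -rmorphD /= -(rmorph1 ofR) ler_of_real.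
  by rewrite !ger0_norm ?divr_ge0 ?(ltW st0)// -mulrDl divff// gt_eqF.
rewrite scalerDr !scalerA -!rmorphM /=.
by congr (ofR _ *: _ + ofR _ *: _); field; rewrite gt_eqF.
Qed.

Lemma le_dilate U s t : absolutely_convex U -> 0 <= s -> s <= t ->
  dilate s U `<=` dilate t U.
Proof.
move=> acU s0 st x sUx; rewrite -[x]addr0 -(subrKC s t).
apply: dilateD => //; first by rewrite subr_ge0.
case: sUx => u Uu _; exists 0; last by rewrite scaler0.
exact: absolutely_convex0 Uu.
Qed.

Lemma dilate_conv U s t x y : absolutely_convex U -> 0 < s -> 0 <= t <= 1 ->
  dilate s U x -> dilate s U y -> dilate s U (ofR t *: x + ofR (1 - t) *: y).
Proof.
move=> acU s0 /andP[t0 t1] Ux Uy.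
have -> : s = t * s + (1 - t) * s by ring.
have t1' : 0 <= 1 - t by lra.
apply: dilateD; rewrite ?mulr_ge0 ?(ltW s0)//.
- rewrite -{1}(ger0_norm t0) -(modulus_of_real (k := k)).
  by apply: dilateZ => //; exact: ltW.
- rewrite -{1}(ger0_norm t1') -(modulus_of_real (k := k)).
  by apply: dilateZ => //; exact: ltW.
Qed.

Lemma nbhs0_dilate t A : 0 < t -> nbhs (0 : X) A -> nbhs (0 : X) (dilate t A).
Proof.
by move=> t0; apply: nbhs0Z; rewrite -(rmorph0 ofR) (inj_eq of_real_inj) gt_eqF.
Qed.

Lemma nbhs0_absorbing A x : nbhs (0 : X) A -> exists2 t, 0 < t & dilate t A x.
Proof.
move=> A0.
have /= := scale_continuous (0, x) A.
rewrite scale0r => /(_ A0)[[B C] /= [B0 Cx]] BCA.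
have [e /= e0 eB] := B0.
have [t t0 et] := gt0_of_realP e0.
exists (t / 2)^-1; first by rewrite invr_gt0 divr_gt0.
apply/dilateP; first by rewrite gt_eqF ?invr_gt0 ?divr_gt0.
rewrite invrK; apply: (BCA (_, _)); split => /=; last exact: nbhs_singleton.
apply: eB; rewrite /= sub0r normrN norm_of_real et ltr_of_real.
by rewrite gtr0_norm ?divr_gt0// ltr_pdivrMr// ltr_pMr// ltr1n.
Qed.

Lemma zero_nbhdsI U V : zero_nbhds U -> zero_nbhds V -> zero_nbhds (U `&` V).
Proof.
move=> [U0 acU] [V0 acV]; split; first exact: filterI.
by move=> a b x y ab [Ux Vx] [Uy Vy]; split; [exact: acU|exact: acV].
Qed.

(** Local convexity provides convex neighbourhoods [C] only. The balanced core [U] of [C], formed by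
    the points whose multiples by scalars of modulus at most 1 all stay in [C], is absolutely
    convex, and it is a neighbourhood by joint continuity of the scalar multiplication at the
    origin. *)
Lemma zero_nbhds_sub A : nbhs (0 : X) A -> exists2 U, zero_nbhds U & U `<=` A.
Proof.
move=> A0; have [B Bconv [Bo Bb]] := @locally_convex _ X.
have [C [BC C0] CA] := Bb 0 A A0.
have Cconv a b x y : 0 <= a -> 0 <= b -> a + b = 1 -> C x -> C y ->
    C (ofR a *: x + ofR b *: y).
  move=> a0 b0 ab Cx Cy.
  have a01 : (0 <= ofR a) && (ofR a <= 1).
    by rewrite -(rmorph0 ofR) -(rmorph1 ofR) !ler_of_real a0 -ab lerDl.
  have /Bconv/(_ x y (Itv01 (proj1 (andP a01)) (proj2 (andP a01)))) : C \in B.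
    exact/mem_set.
  rewrite !inE => /(_ Cx Cy); congr C.
  rewrite /conv /=; congr (_ + _ *: _).
  by rewrite /unstable.onem -(rmorph1 ofR) -rmorphB -ab addrAC subrr add0r.
pose U := [set x : X | forall c : K, `|c| <= 1 -> C (c *: x)].
exists U; last by move=> x /(_ 1); rewrite normr1 scale1r => /(_ (lexx _))/CA.
split.
  have /= := scale_continuous (0, 0 : X) C; rewrite scale0r.
  have Cn : nbhs 0 C by apply: open_nbhs_nbhs; split => //; exact: Bo.
  move=> /(_ Cn)[[D E] /= [D0 E0] DEC].
  have [e /= e0 eD] := D0.
  have [t t0 et] := gt0_of_realP e0.
  have t20 : 0 < t / 2 by rewrite divr_gt0.
  apply: filterS (nbhs0_dilate t20 E0) => _ [u Eu <-] c c1.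
  rewrite scalerA; apply: (DEC (_, _)); split => //=; apply: eD => /=.
  rewrite sub0r normrN normrM norm_of_real et.
  apply: le_lt_trans (ler_wpM2r _ c1) _ => //.
    by rewrite -(rmorph0 ofR) ler_of_real.
  rewrite mul1r ltr_of_real gtr0_norm//.
  by rewrite ltr_pdivrMr// ltr_pMr// ltr1n.
(* Since [C] contains 0, weights of sum at most 1 can be completed to a convex combination. *)
have Csub a b x y : 0 <= a -> 0 <= b -> a + b <= 1 -> C x -> C y ->
    C (ofR a *: x + ofR b *: y).
  move=> a0 b0 ab Cx Cy.
  have [a1|a_neq1] := eqVneq a 1.
    have -> : b = 0 by lra.
    by rewrite a1 rmorph1 rmorph0 scale1r scale0r addr0.
  have a1 : 0 < 1 - a by rewrite subr_gt0 lt_neqAle a_neq1; lra.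
  have -> : ofR b *: y = ofR (1 - a) *: (ofR (b / (1 - a)) *: y +
      ofR (1 - b / (1 - a)) *: 0).
    rewrite scaler0 addr0 scalerA -rmorphM /=; congr (ofR _ *: _).
    by field; rewrite gt_eqF.
  apply: (Cconv); rewrite ?(ltW a1)//; first by lra.
  have b1 : b / (1 - a) <= 1 by rewrite ler_pdivrMr//; lra.
  by apply: Cconv; rewrite ?divr_ge0 ?(ltW a1)// ?subr_ge0//; lra.
move=> a b x y ab Ux Uy c c1.
(* Polar decomposition: the modulus of [d] becomes a convex weight, and the remaining factor, of
   modulus at most 1, is absorbed by the balanced core. For [d = 0] the quotient is 0. *)
have scaleE (d : K) (z : X) :
    c *: (d *: z) = ofR (modulus d) *: ((c * (d / `|d|)) *: z).
  have [->|d0] := eqVneq d 0.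
    by rewrite !(scale0r, mul0r, mulr0, scaler0).
  by rewrite scalerA -modulusE scalerA mulrCA [`|d| * _]mulrC divfK ?normr_eq0.
have cd1 (d : K) : `|c * (d / `|d|)| <= 1.
  have [->|d0] := eqVneq d 0; first by rewrite mul0r mulr0 normr0.
  by rewrite normrM normf_div normr_id divff ?normr_eq0// mulr1.
rewrite scalerDr !scaleE; apply: Csub; rewrite ?modulus_ge0//.
- by rewrite -(ler_of_real (k := k)) rmorphD rmorph1 /= -!modulusE.
- exact: Ux.
- exact: Uy.
Qed.

End AbsolutelyConvex.

(** * Minkowski functionals of zero neighbourhoods *)

Section Gauge.
Context {R : realType} {k : scalar_kind} {X : tvsType (scalars R k)}.
Local Notation K := (scalars R k).
Local Notation ofR := (of_real (R := R) k).
Local Notation gauge := minkowski_functional.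
Variable U : set X.
Hypothesis Unbhs : zero_nbhds U.
Implicit Types (x y : X) (s t : R).

Let acU : absolutely_convex U := proj2 Unbhs.

Let gauge_has_inf x : has_inf [set t : R | 0 < t /\ dilate t U x].
Proof.
split; last by exists 0 => t [/ltW].
by have [t t0 tx] := nbhs0_absorbing x (proj1 Unbhs); exists t.
Qed.

Lemma gauge_ge0 x : 0 <= gauge U x.
Proof.
by apply: lb_le_inf; [exact: (gauge_has_inf x).1|move=> t [/ltW]].
Qed.

Lemma gauge_le x t : 0 < t -> dilate t U x -> gauge U x <= t.
Proof. by move=> t0 tx; apply: ge_inf; [exact: (gauge_has_inf x).2|split]. Qed.

Lemma gauge_lt x t : gauge U x < t -> dilate t U x.
Proof.
move=> /inf_lt[|s /= [s0 sx] st]; first exact: (gauge_has_inf x).1.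
exact: le_dilate (ltW s0) (ltW st) _ sx.
Qed.

Lemma gaugeD x y : gauge U (x + y) <= gauge U x + gauge U y.
Proof.
apply/ler_addgt0Pr => e e0.
have h z : gauge U z < gauge U z + e / 2 by rewrite ltrDl divr_gt0.
have -> : gauge U x + gauge U y + e = (gauge U x + e / 2) + (gauge U y + e / 2).
  by field.
have h0 z : 0 < gauge U z + e / 2 by rewrite ltr_wpDl ?gauge_ge0 ?divr_gt0.
apply: gauge_le; first by rewrite addr_gt0.
by apply: dilateD; rewrite ?(ltW (h0 _))//; exact: gauge_lt.
Qed.

Lemma gaugeZ a x : gauge U (a *: x) <= modulus a * gauge U x.
Proof.
apply/ler_addgt0Pr => e e0.
have a0 := modulus_ge0 a; have gx0 := gauge_ge0 x.
(* This slack costs less than [e] after multiplication by [modulus a]; the added 1 covers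
   [a = 0]. *)
have d0 : 0 < e / (modulus a + 1) by rewrite divr_gt0 ?ltr_wpDl.
apply: gauge_le; first by rewrite ltr_wpDl ?mulr_ge0.
apply: (@le_dilate _ _ _ _
  (modulus a * (gauge U x + e / (modulus a + 1)))) => //.
- by rewrite mulr_ge0// addr_ge0// ltW.
- rewrite mulrDr lerD2l mulrA ler_pdivrMr ?ltr_wpDl//.
  by rewrite mulrC ler_pM2l// lerDl.
- apply: dilateZ => //; first by rewrite addr_ge0// ltW.
  by apply: gauge_lt; rewrite ltrDl.
Qed.

End Gauge.

(** * Near-minimizers and bounds on finite sets *)

Lemma near_minimizer (R : realType) (T : Type) (S : set T) (g : T -> R) (c : R)
    (x0 : T) :
  (forall x, 0 <= g x) -> S x0 -> 0 < c ->
  exists x, [/\ S x, g x <= g x0 & forall y, S y -> g x <= g y + c].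
Proof.
move=> g0 Sx0 c0.
have gS : has_inf [set g x | x in S].
  by split; [exists (g x0), x0|exists 0 => _ [x _ <-]].
(* A point within [c] of the infimum; if [x0] does better than it, [x0] itself is a
   near-minimizer. *)
have [_ [x Sx <-] xc] := inf_adherent c0 gS.
have xmin y : S y -> g x <= g y + c.
  move=> Sy; apply: le_trans (ltW xc) _; rewrite lerD2r.
  by apply: ge_inf; [exact: gS.2|exists y].
have [xx0|x0x] := leP (g x) (g x0); first by exists x.
by exists x0; split => // y Sy; apply: le_trans (ltW x0x) (xmin _ Sy).
Qed.

Lemma finite_set_bound (R : realType) (T : choiceType) (F : set T)
    (g : T -> R) :
  finite_set F ->
  exists2 M : R, 0 < M & forall x, F x -> g x <= M.
Proof.
move=> /finite_seqP[s ->]; elim: s => [|x s [M M0 IH]]; first by exists 1.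
exists (Num.max M (g x)); first by rewrite lt_max M0.
move=> y /=; rewrite in_cons => /orP[/eqP->|/IH yM].
  by rewrite le_max lexx orbT.
by rewrite le_max yM.
Qed.

(** * Hilbertian seminorms and approximate orthogonality *)

Section HilbertianSeminorm.
Context {R : realType} {k : scalar_kind} {X : tvsType (scalars R k)}.
Local Notation K := (scalars R k).
Local Notation ofR := (of_real (R := R) k).
Implicit Types (x y z : X) (s t : R).

Definition real_inner_product (b : X -> X -> R) : Prop :=
  [/\ forall x y, b x y = b y x,
      forall x y z, b (x + y) z = b x z + b y z,
      forall t x y, b (ofR t *: x) y = t * b x y &
      forall x, 0 <= b x x].

(* Over the complex numbers only the real part of the scalar product is kept. *)
Definition hilbertian (p : X -> R) : Prop :=
  [/\ forall x, 0 <= p x,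
      forall a x, p (a *: x) = modulus a * p x &
      exists2 b, real_inner_product b & forall x, b x x = p x ^+ 2].

(** The discriminant of a nonnegative quadratic polynomial. It is evaluated at its vertex [b / a],
    or, when [a = 0] and [b] is nonzero, at the point where the affine function equals -1. *)
Lemma nonneg_quadratic (a b c : R) : 0 <= a ->
  (forall t, 0 <= c - (t * b) *+ 2 + t ^+ 2 * a) -> b ^+ 2 <= c * a.
Proof.
move=> a0 h; have [a_eq0|a_neq0] := eqVneq a 0.
  have [->|b0] := eqVneq b 0; first by rewrite expr0n a_eq0 mulr0.
  have := h ((c + 1) / (b *+ 2)); rewrite a_eq0 mulr0 addr0 leNgt => /negP[].
  have -> : c - ((c + 1) / (b *+ 2) * b) *+ 2 = -1 by field.
  by rewrite ltrN10.
have a1 : 0 < a by rewrite lt_neqAle eq_sym a_neq0.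
have := h (b / a).
have -> : c - (b / a * b) *+ 2 + (b / a) ^+ 2 * a = c - b ^+ 2 / a by field.
by rewrite subr_ge0 ler_pdivrMr.
Qed.

Section InnerProduct.
Variables (p : X -> R) (b : X -> X -> R).
Hypotheses (pH : hilbertian p) (bP : real_inner_product b).
Hypothesis bE : forall x, b x x = p x ^+ 2.

Lemma inner_productZD s t x y z :
  b (ofR s *: x + ofR t *: y) z = s * b x z + t * b y z.
Proof. by case: bP => _ bD bZ _; rewrite bD !bZ. Qed.

Lemma inner_productDr x y z : b x (y + z) = b x y + b x z.
Proof. by case: bP => bC bD _ _; rewrite bC bD ![b _ x]bC. Qed.

Lemma inner_productZr t x y : b x (ofR t *: y) = t * b x y.
Proof. by case: bP => bC _ bZ _; rewrite bC bZ ![b _ x]bC. Qed.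

Lemma hilbertian_sqr_comb s t x y : p (ofR s *: x + ofR t *: y) ^+ 2 =
  s ^+ 2 * p x ^+ 2 + t ^+ 2 * p y ^+ 2 + (s * t * b x y) *+ 2.
Proof.
rewrite -!bE inner_productZD !inner_productDr !inner_productZr.
by have [bC _ _ _] := bP; rewrite (bC y x); ring.
Qed.

Lemma cauchy_schwarz x y : `|b x y| <= p x * p y.
Proof.
have [p0 _ _] := pH.
rewrite -(@ler_pXn2r _ 2)// ?nnegrE ?mulr_ge0// real_normK ?num_real// exprMn.
apply: nonneg_quadratic => [|t]; first by rewrite sqr_ge0.
have := sqr_ge0 (p (ofR 1 *: x + ofR (- t) *: y)).
rewrite hilbertian_sqr_comb; congr (0 <= _); ring.
Qed.

Lemma hilbertianD x y : p (x + y) <= p x + p y.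
Proof.
have [p0 _ _] := pH.
rewrite -(@ler_pXn2r _ 2)// ?nnegrE ?addr_ge0//.
have := hilbertian_sqr_comb 1 1 x y; rewrite rmorph1 !scale1r => ->.
have := le_trans (ler_norm _) (cauchy_schwarz x y).
by rewrite sqrrD; lra.
Qed.

(** Along the line spanned by [l], near-minimality of 0 says that
    [c - 2 t b x l + t ^+ 2 * p l ^+ 2] is nonnegative for all [t], so its discriminant is not
    positive. For [c = 0] this is the orthogonality of the error of a best approximation. *)
Lemma nearly_orthogonal (L : set X) (c : R) x :
  (forall t l, L l -> L (ofR t *: l)) ->
  (forall l, L l -> p x ^+ 2 <= p (x - l) ^+ 2 + c) ->
  forall l, L l -> b x l ^+ 2 <= c * p l ^+ 2.
Proof.
move=> LZ xmin l Ll; apply: nonneg_quadratic => [|t]; first exact: sqr_ge0.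
have := xmin _ (LZ t _ Ll).
have -> : x - ofR t *: l = ofR 1 *: x + ofR (- t) *: l.
  by rewrite rmorph1 scale1r rmorphN scaleNr.
by rewrite hilbertian_sqr_comb; lra.
Qed.

End InnerProduct.

Lemma hilbertian_le_add p x y : hilbertian p -> p (x + y) <= p x + p y.
Proof. by move=> pH; have [_ _ [b bP bE]] := pH; exact: hilbertianD bE _ _. Qed.

Lemma hilbertianN p x : hilbertian p -> p (- x) = p x.
Proof.
move=> [_ pZ _].
by rewrite -scaleN1r pZ -(rmorph1 ofR) -rmorphN modulus_of_real normrN1 mul1r.
Qed.

Lemma hilbertian_ballE p t : hilbertian p -> 0 < t ->
  dilate t [set x | p x < 1] = [set x | p x < t].
Proof.
move=> [_ pZ _] t0; apply/seteqP; split => x.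
  move=> [u /= u1 <-]; rewrite pZ modulus_of_real gtr0_norm//.
  by rewrite -ltr_pdivlMl// mulVf// gt_eqF.
move=> /= xt; apply/dilateP; first by rewrite gt_eqF.
rewrite /= pZ modulus_of_real gtr0_norm ?invr_gt0//.
by rewrite mulrC ltr_pdivrMr// mul1r.
Qed.

Lemma hilbertian_ball_absolutely_convex p : hilbertian p ->
  absolutely_convex [set x : X | p x < 1].
Proof.
move=> pH a b x y ab /= x1 y1.
have [pge0 pZ _] := pH.
apply: le_lt_trans (hilbertian_le_add _ _ pH) _; rewrite !pZ.
have ab1 : modulus a + modulus b <= 1.
  by rewrite -(ler_of_real (k := k)) rmorphD rmorph1 /= -!modulusE.
have a0 := modulus_ge0 a; have b0 := modulus_ge0 b.
(* The maximum is still below 1, which keeps the inequality strict. *)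
apply: (@le_lt_trans _ _ (Num.max (p x) (p y))); last first.
  by rewrite gt_max x1 y1.
have M0 : 0 <= Num.max (p x) (p y) by rewrite le_max pge0.
apply: le_trans (_ : (modulus a + modulus b) * Num.max (p x) (p y) <= _).
  by rewrite mulrDl lerD// ler_wpM2l// le_max lexx ?orbT.
by rewrite ler_piMl.
Qed.

End HilbertianSeminorm.

(** * Contraction of precompact balls modulo a subspace *)

Section CompactContraction.
Context {R : realType} {k : scalar_kind} {X : tvsType (scalars R k)}.
Local Notation K := (scalars R k).
Local Notation ofR := (of_real (R := R) k).
Implicit Types (x y : X) (s t : R).

(** The threshold [d0] depends on a finite net of the [p]-ball and on how [W] absorbs points
    attached to it, but not on [L]. The gain [e] is therefore uniform over subspaces of all
    dimensions. *)
Lemma contract_modulo_subspace (U W : set X) (p : X -> R) (e : R) :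
  zero_nbhds U -> hilbertian p ->
  [set x | p x < 1] `<=` U ->
  (forall r, 0 < r -> exists2 F : set X, finite_set F &
     forall v, p v < 1 -> exists2 x, F x & dilate r U (v - x)) ->
  (forall x, exists2 r, 0 < r & dilate r W x) -> 0 < e ->
  exists2 d0, 0 < d0 & forall d (L : set X), 0 < d -> d < d0 ->
    (forall x y, L x -> L y -> L (x + y)) ->
    (forall t x, L x -> L (ofR t *: x)) ->
    W `<=` [set u + l | u in dilate d [set x | p x < 1] & l in L] ->
    W `<=` [set u + l | u in dilate (d * e) U & l in L].
Proof.
move=> UP pH VU pre Wabs e0; have [_ acU] := UP; have [p0 pZ [b bP bE]] := pH.
(* At the end [v] is written as [(v - x) - (f - x) + f], with each summand in [e' U]. *)
pose e' := e / 3; have e'0 : 0 < e' by rewrite divr_gt0.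
(* [s] is the weight of [v] in the competitor built below and governs the tolerances; it is small
   enough for the final bound [p f ^+ 2 <= 3 * s] to give [p f < e']. *)
pose s := Num.min 1 (e' ^+ 2 / 4).
have s0 : 0 < s by rewrite lt_min ltr01 divr_gt0// exprn_gt0.
have s1 : s <= 1 by rewrite ge_min lexx.
have s_e : 3 * s < e' ^+ 2.
  have : s <= e' ^+ 2 / 4 by rewrite ge_min lexx orbT.
  by have : 0 < e' ^+ 2; [rewrite exprn_gt0|lra].
have [F finF Fnet] := pre e' e'0.
pose S x := [set y | p y < 1 /\ dilate e' U (y - x)].
(* To a net point [x] is attached a near-minimizer [f] of [p] among the points of the [p]-ball close
   to [x], with a radius at which [W] absorbs [f]. The pair [(0, 1)] is a default for empty
   [S x]. *)
have /choice[fr frP] : forall x, exists fr : X * R, 0 < fr.2 /\ (S x !=set0 ->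
    [/\ S x fr.1, dilate fr.2 W fr.1 &
        forall y, S x y -> p fr.1 ^+ 2 <= p y ^+ 2 + s ^+ 2]).
  move=> x; have [[y Sy]|S0] := pselect (S x !=set0); last by exists (0, 1).
  have [z||f [Sf _ fmin]] :=
    @near_minimizer R X (S x) (fun y => p y ^+ 2) (s ^+ 2) y _ Sy.
  - by rewrite sqr_ge0.
  - by rewrite exprn_gt0.
  by have [r r0 rW] := Wabs f; exists (f, r).
have [M M0 FM] := finite_set_bound (fun x => (fr x).2) finF.
(* For smaller [d] one has [M * d <= s / 8], so that an attached [f], lying in [r W] with [r <= M],
   is within [s / 8] of [L]. *)
exists (s / 8 / M); first by rewrite !divr_gt0.
move=> d L d0 dM LD LZ WL w Ww; have [u du [l0 Ll0 uw]] := WL w Ww.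
have d_neq0 : d != 0 by rewrite gt_eqF.
(* The comparison with [l0] keeps [p (w - l)] below [d]. After division by [d] the tolerance becomes
   [(s / 8) ^+ 2]. *)
have [|||l [Ll lmin0 lmin]] := @near_minimizer R X L (fun l => p (w - l) ^+ 2)
  ((d * (s / 8)) ^+ 2) l0; rewrite ?exprn_gt0 ?mulr_gt0 ?divr_gt0//.
  by move=> z; rewrite sqr_ge0.
have pwl : p (w - l) < d.
  have pwl0 : p (w - l0) < d.
    by move: du; rewrite hilbertian_ballE//= -uw addrK.
  by apply: le_lt_trans pwl0; rewrite -(@ler_pXn2r _ 2)// nnegrE.
pose v := ofR d^-1 *: (w - l).
have vE : ofR d *: v = w - l by rewrite scale_of_realK.
have pv : p v < 1.
  by rewrite pZ modulus_of_real gtr0_norm ?invr_gt0// mulrC ltr_pdivrMr// mul1r.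
have v_orth y : L y -> `|b v y| <= s / 8 * p y.
  move=> Ly; have s8 : 0 <= s / 8 * p y by rewrite mulr_ge0// divr_ge0// ltW.
  rewrite -(@ler_pXn2r _ 2)// ?nnegrE// real_normK ?num_real//.
  have [_ _ bZ _] := bP; rewrite bZ [leLHS]exprMn exprVn.
  rewrite ler_pdivrMl ?exprn_gt0// -exprMn mulrA exprMn.
  apply: (nearly_orthogonal bP bE LZ _ Ly) => l' Ll'.
  by rewrite -addrA -opprD; apply: lmin; exact: LD.
have [x Fx vx] := Fnet v pv.
have Sv : S x v by [].
have [r0 /(_ (ex_intro _ v Sv))[]] := frP x.
set f := (fr x).1; set r := (fr x).2 => -[pf fx] fW fmin.
have [l2 Ll2 fl2] : exists2 l2, L l2 & p (f - l2) <= s / 8.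
  have [w' Ww' <-] := fW; have [u' du' [l' Ll' <-]] := WL w' Ww'.
  exists (ofR r *: l'); first exact: LZ.
  rewrite scalerDr addrK pZ modulus_of_real gtr0_norm//.
  have pu' : p u' < d by move: du'; rewrite hilbertian_ballE.
  have rM : r <= M by exact: FM.
  apply: le_trans (_ : M * d <= _).
    by apply: ler_pM => //; exact: ltW.
  by rewrite mulrC -ler_pdivlMr// ltW.
(* Near orthogonality bounds [b v l2] by [s / 8 * 2], and Cauchy-Schwarz bounds [b v (f - l2)] by
   [s / 8]. *)
have bvf : b v f <= s / 2.
  have pl2 : p l2 <= 2.
    have := hilbertian_le_add f (- (f - l2)) pH.
    rewrite hilbertianN// opprB addrC subrK; move=> h; lra.
  have := v_orth _ Ll2; have := cauchy_schwarz pH bP bE v (f - l2).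
  have := ler_norm (b v l2); have := ler_norm (b v (f - l2)).
  have -> : b v f = b v l2 + b v (f - l2).
    by rewrite -(inner_productDr bP) addrC subrK.
  have : p v * p (f - l2) <= s / 8.
    by apply: le_trans (ler_piMl _ (ltW pv)) fl2.
  have : s / 8 * p l2 <= s / 8 * 2 by rewrite ler_pM2l ?divr_gt0.
  by lra.
(* As [v] is nearly orthogonal to [f], the competitor [s v + (1 - s) f] would
   beat the near-minimizer [f] if [p f] were not small. *)
have pf_small : p f ^+ 2 <= 3 * s.
  pose y := ofR s *: v + ofR (1 - s) *: f.
  have s01 : 0 <= s <= 1 by rewrite (ltW s0).
  have Sy : S x y.
    split.
      have acV := hilbertian_ball_absolutely_convex pH.
      have := @dilate_conv _ _ _ _ 1 s v f acV ltr01 s01.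
      by rewrite dilate1; exact.
    have -> : y - x = ofR s *: (v - x) + ofR (1 - s) *: (f - x).
      rewrite !scalerBr addrACA -opprD -scalerDl -rmorphD /=.
      by rewrite [s + _]addrC subrK rmorph1 scale1r.
    exact: dilate_conv.
  have := fmin y Sy; rewrite (hilbertian_sqr_comb bP bE).
  have : p v ^+ 2 <= 1 by rewrite expr_le1// ltW.
  have : p f ^+ 2 <= 1 by rewrite expr_le1// ltW.
  have := sqr_ge0 (p f).
  move: (p f ^+ 2) (p v ^+ 2) => m n m0 m1 n1 h.
  have sb : s * (1 - s) * b v f <= s * (1 - s) * (s / 2).
    by rewrite ler_wpM2l// mulr_ge0 ?subr_ge0// ltW.
  have sn : s ^+ 2 * n <= s ^+ 2 by rewrite ler_piMr// sqr_ge0.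
  have sm : 0 <= s * (1 - s) * m by rewrite !mulr_ge0 ?subr_ge0// ltW.
  have s3 : 0 <= s ^+ 3 by rewrite exprn_ge0// ltW.
  (* Expanding the comparison gives [s * (2 - s) * m <= 3 * s ^+ 2 - s ^+ 3], and [2 - s] is at
     least 1. *)
  rewrite -(ler_pM2l s0); lra.
have pfe : p f < e'.
  by rewrite -(@ltr_pXn2r _ 2)// ?nnegrE ?(ltW e'0)//; lra.
exists (w - l); last by exists l; rewrite ?subrK.
rewrite -vE -dilateM; exists v => //.
have -> : v = (v - x) + (- (f - x) + f) by rewrite opprB !subrK.
have -> : e = e' + (e' + e') by rewrite /e'; field.
apply: dilateD; rewrite ?addr_ge0 ?(ltW e'0)//.
apply: dilateD; rewrite ?(ltW e'0)//; first by apply: dilateN => //; exact: ltW.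
by apply: dilateS VU _ _; rewrite hilbertian_ballE.
Qed.

End CompactContraction.

(** * Null sequences of extended reals, and Kolmogorov widths *)

Lemma cvge0P (R : realType) (u : nat -> \bar R) : u n @[n --> \oo] --> 0%E <->
  forall e, 0 < e -> \forall n \near \oo, (`|u n| <= e%:E)%E.
Proof.
split=> [u0 e e0|u0 A].
  apply: (u0 [set x | (`|x| <= e%:E)%E]).
  exists e => //= r; rewrite /= sub0r normrN => re.
  by rewrite /= lee_fin ltW.
move=> [e /= e0 eA]; have e20 : 0 < e / 2 by rewrite divr_gt0.
apply: filterS (u0 _ e20) => n; rewrite /=.
case: (u n) => [r| |] //=; rewrite ?leye_eq// lee_fin => re.
apply: eA => /=; rewrite sub0r normrN; apply: le_lt_trans re _.
by rewrite ltr_pdivrMr// ltr_pMr// ltr1n.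
Qed.

Section Widths.
Context {R : realType} {k : scalar_kind} {X : tvsType (scalars R k)}.
Local Notation K := (scalars R k).
Local Notation ofR := (of_real (R := R) k).
Local Notation delta := kolmogorov_width.
Local Notation gauge := minkowski_functional.
Implicit Types (U V W A B L : set X) (x y : X) (s t d e : R) (n : nat).

Lemma dim_at_mostD n L x y : dim_at_most n L -> L x -> L y -> L (x + y).
Proof.
move=> [v ->] [a ->] [b ->]; exists (fun i => a i + b i).
by rewrite -big_split /=; apply: eq_bigr => i _; rewrite scalerDl.
Qed.

Lemma dim_at_mostZ n L a x : dim_at_most n L -> L x -> L (a *: x).
Proof.
move=> [v ->] [b ->]; exists (fun i => a * b i).
by rewrite scaler_sumr; apply: eq_bigr => i _; rewrite scalerA.
Qed.

Lemma dim_at_most_span n (s : seq X) : (size s <= n)%N ->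
  exists2 L : set X, dim_at_most n L & forall x, x \in s -> L x.
Proof.
(* A list shorter than [n] is padded with zero vectors. *)
move=> sn; pose v (i : 'I_n) := nth 0 s i.
exists [set x | exists c : 'I_n -> K, x = \sum_(i < n) c i *: v i].
  by exists v.
move=> x xs.
have xn : (index x s < n)%N by rewrite (leq_trans _ sn)// index_mem.
exists (fun i => (i == Ordinal xn)%:R).
rewrite (bigD1 (Ordinal xn))//= eqxx scale1r big1 ?addr0 /v ?nth_index//.
by move=> i /negbTE ->; rewrite scale0r.
Qed.

(** The condition under the infimum that defines [kolmogorov_width]. *)
Definition approximable n V U d := 0 < d /\
  exists L, dim_at_most n L /\ V `<=` [set u + l | u in dilate d U & l in L].

Lemma width_ge0 n V U : (0 <= delta n V U)%E.
Proof. by apply: le_ereal_inf_tmp => _ [d [d0 _] <-]; rewrite lee_fin ltW. Qed.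

Lemma width_le n V U d : approximable n V U d -> (delta n V U <= d%:E)%E.
Proof. by move=> Vd; apply: ereal_inf_lbound; exists d. Qed.

Lemma le_approximable n V U d d' : absolutely_convex U -> d <= d' ->
  approximable n V U d -> approximable n V U d'.
Proof.
move=> acU dd' [d0 [L [Ln VL]]]; split; first exact: lt_le_trans dd'.
exists L; split => // x /VL[u du [l Ll <-]]; exists u; last by exists l.
exact: le_dilate (ltW d0) dd' _ du.
Qed.

Lemma width_le_scale n V U V' U' c : 0 < c ->
  (forall d, approximable n V U d -> approximable n V' U' (c * d)) ->
  (delta n V' U' <= c%:E * delta n V U)%E.
Proof.
move=> c0 h; rewrite -lee_pdivrMl//.
apply: le_ereal_inf_tmp => _ [d /h Vd <-].
by rewrite lee_pdivrMl// -EFinM; exact: width_le.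
Qed.

Lemma width_dilate n B V U r : 0 < r -> B `<=` dilate r V ->
  (delta n B U <= r%:E * delta n V U)%E.
Proof.
move=> r0 BV; apply: width_le_scale => // d [d0 [L [Ln VL]]].
split; first exact: mulr_gt0.
exists L; split => // _ /BV[x /VL[u du [l Ll <-]] <-].
exists (ofR r *: u); first by rewrite -dilateM; exists u.
exists (ofR r *: l); first exact: dim_at_mostZ Ln Ll.
by rewrite scalerDr.
Qed.

Lemma le_width n V V' U U' : V `<=` V' -> U' `<=` U ->
  (delta n V U <= delta n V' U')%E.
Proof.
move=> VV' UU'; rewrite -[leRHS]mul1e; apply: width_le_scale => // d.
rewrite mul1r => -[d0 [L [Ln VL]]]; split => //; exists L; split => //.
move=> x /VV' /VL[u du [l Ll <-]]; exists u; last by exists l.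
exact: dilateS du.
Qed.

Lemma absorbed_approximable n B U r : 0 < r -> B `<=` dilate r U ->
  approximable n B U r.
Proof.
move=> r0 BU; have [L Ln _] := @dim_at_most_span n [::] isT; split => //.
exists L; split => // x Bx; exists x; first exact: BU.
exists 0; last by rewrite addr0.
by have [v ->] := Ln; exists (fun=> 0); rewrite big1// => i _; rewrite scale0r.
Qed.

Lemma width_perturbation n V F U r : absolutely_convex U -> 0 < r ->
  (forall v, V v -> exists2 x, F x & dilate r U (v - x)) ->
  (delta n V U <= delta n F U + r%:E)%E.
Proof.
move=> acU r0 VF; rewrite -leeBlDr//.
apply: le_ereal_inf_tmp => _ [d [d0 [L [Ln FL]]] <-].
rewrite leeBlDr// -EFinD; apply: width_le; split; first exact: addr_gt0.
exists L; split => // v /VF[x /FL[u du [l Ll <-]] vx].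
exists (u + (v - (u + l))); first by apply: dilateD => //; exact: ltW.
by exists l => //; rewrite addrC addrA [l + u]addrC addrC subrK.
Qed.

Lemma precompact_net U V r : zero_nbhds U -> precompact_wrt (gauge U) V ->
  0 < r -> exists2 F, finite_set F &
    forall v, V v -> exists2 x, F x & dilate r U (v - x).
Proof.
move=> UP Vpre r0; have [F [finF VF]] := Vpre r r0.
exists F => // v /VF[x [Fx vx]].
by exists x => //; exact: gauge_lt.
Qed.

(** The centres of a net need not lie in [V']. Each useful one is replaced by a point of [V'] close
    to it, which doubles the radius; hence the net of radius [r / 2]. *)
Lemma precompact_inner_net U V V' r : zero_nbhds U ->
  precompact_wrt (gauge U) V -> V' `<=` V -> 0 < r ->
  exists F, [/\ finite_set F, F `<=` V' &
    forall v, V' v -> exists2 x, F x & dilate r U (v - x)].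
Proof.
move=> UP Vpre V'V r0; have [_ acU] := UP.
have r20 : 0 < r / 2 by rewrite divr_gt0.
have [F finF VF] := precompact_net UP Vpre r20.
pose S x := [set y | V' y /\ dilate (r / 2) U (y - x)].
have /choice[g gP] : forall x, exists y, S x !=set0 -> S x y.
  by move=> x; have [[y Sy]|S0] := pselect (S x !=set0); [exists y|exists 0].
exists (g @` (F `&` [set x | S x !=set0])); split.
- by apply: finite_image; exact: finite_setIl.
- by move=> _ [x [_ Sx] <-]; have [] := gP x Sx.
move=> v V'v; have [x Fx vx] := VF _ (V'V _ V'v).
have Sx : S x !=set0 by exists v.
exists (g x); first by exists x.
have [_ gx] := gP _ Sx.
have -> : v - g x = (v - x) + - (g x - x) by rewrite opprB addrA subrK.
have -> : r = r / 2 + r / 2 by field.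
by apply: dilateD; rewrite ?ltW//; apply: dilateN => //; exact: ltW.
Qed.

(** Once [n] reaches the size of a finite net, the span of the net serves as the subspace. *)
Lemma precompact_approximable U V r : zero_nbhds U ->
  precompact_wrt (gauge U) V -> 0 < r ->
  \forall n \near \oo, approximable n V U r.
Proof.
move=> UP Vpre r0; have [_ /finite_seqP[s ->] VF] := precompact_net UP Vpre r0.
exists (size s) => // n /= sn; have [L Ln sL] := dim_at_most_span sn.
split => //; exists L; split => // v /VF[x /= xs vx].
by exists (v - x) => //; exists x; [exact: sL|rewrite subrK].
Qed.

End Widths.

(** * The inclusions between the four sets of sequences *)

Section Diametral.
Context {R : realType} {k : scalar_kind} (X : tvsType (scalars R k)).
Local Notation K := (scalars R k).
Local Notation ofR := (of_real (R := R) k).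
Local Notation delta := kolmogorov_width.
Local Notation gauge := minkowski_functional.
Implicit Types (U V W A B L : set X) (x y : X) (s t d e : R) (n : nat).

Lemma abse_scaled_width (a : R) n V U :
  (`|a%:E * delta n V U| = `|a|%:E * delta n V U)%E.
Proof. by rewrite abseM (gee0_abs (width_ge0 _ _ _)). Qed.

Lemma Delta_sub_Delta_b : Delta X `<=` Delta_b X.
Proof.
move=> xi xiD U UP B Bb; have [V [VP /cvge0P xiV]] := xiD U UP.
have [r [r0 BV]] := Bb V (proj1 VP).
apply/cvge0P => e e0; apply: filterS (xiV _ (divr_gt0 e0 r0)) => n.
rewrite !abse_scaled_width => xn.
apply: le_trans (lee_wpmul2l _ (width_dilate n U r0 BV)) _.
  by rewrite lee_fin.
rewrite muleCA.
apply: le_trans (lee_wpmul2l _ xn) _; first by rewrite lee_fin ltW.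
by rewrite -EFinM lee_fin mulrCA mulfV ?mulr1// gt_eqF.
Qed.

Lemma Delta_b_sub_Delta_b_infty : Delta_b X `<=` Delta_b_infty X.
Proof.
move=> xi xiD U UP B Bb; have /cvge0P/(_ 1 ltr01)[N _ xiN] := xiD U UP B Bb.
have [r [r0 BU]] := Bb U (proj1 UP).
have S0 m : 0 <= \sum_(i < m) `|xi i| * r.
  by apply: sumr_ge0 => i _; rewrite mulr_ge0// ltW.
(* Beyond [N] the terms are at most 1. Before [N] the widths are at most [r], with the zero
   subspace, because [U] absorbs [B]. *)
exists (1 + \sum_(i < N) `|xi i| * r) => n; have [Nn|nN] := leqP N n.
  by apply: le_trans (xiN n Nn) _; rewrite lee_fin lerDl.
rewrite abse_scaled_width.
apply: le_trans (lee_wpmul2l _ (width_le (absorbed_approximable n r0 BU))) _.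
  by rewrite lee_fin.
rewrite -EFinM lee_fin (bigD1 (Ordinal nN))//= addrCA lerDl addr_ge0//.
by apply: sumr_ge0 => i _; rewrite mulr_ge0// ltW.
Qed.

Lemma metrizable_nbhs0_basis : metrizable X ->
  exists A : nat -> set X, (forall j, nbhs 0 (A j)) /\
    forall B, nbhs 0 B -> exists J, forall j, (J <= j)%N -> A j `<=` B.
Proof.
move=> [d [d0 deq dC dD dnbhs]].
exists (fun j => [set y | d 0 y < j.+1%:R^-1]); split => [j|B].
  by apply/dnbhs; exists j.+1%:R^-1; split => //; rewrite invr_gt0.
move=> /dnbhs[e [e0 eB]]; exists (Num.truncn e^-1) => j ej.
apply: subset_trans eB =>  y /= dy; apply: lt_le_trans dy _.
rewrite invf_ple ?posrE//; apply: ltW.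
apply: lt_le_trans (truncnS_gt _) _.
by rewrite ler_nat ltnS.
Qed.

(** All but finitely many [F j] lie in a given neighbourhood, and the union of the others is finite,
    hence absorbed. *)
Lemma bounded_bigcup_null (A F : nat -> set X) : 
  (forall B, nbhs 0 B -> exists J, forall j, (J <= j)%N -> A j `<=` B) ->
  (forall j, finite_set (F j)) -> (forall j, F j `<=` A j) ->
  bounded_sets (\bigcup_j F j).
Proof.
move=> Abase finF FA C /zero_nbhds_sub[D [D0 acD] DC].
have [J JA] := Abase D D0.
have fin_abs (G : set X) : finite_set G -> exists2 r, 0 < r & G `<=` dilate r D.
  move=> finG; have /choice[g gP] : forall x, exists r, 0 < r /\ dilate r D x.
    by move=> x; have [r r0 rx] := nbhs0_absorbing x D0; exists r.
  have [M M0 GM] := finite_set_bound g finG; exists M => // x Gx.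
  by have [g0 gx] := gP x; exact: le_dilate (ltW g0) (GM _ Gx) _ gx.
have [r r0 FD] : exists2 r, 0 < r & \bigcup_(j in `I_J) F j `<=` dilate r D.
  by apply: fin_abs; apply: bigcup_finite.
exists (Num.max 1 r); split; first by rewrite lt_max ltr01.
move=> x [j _ Fjx]; apply: dilateS DC _ _.
have [Jj|jJ] := leqP J j.
  have : dilate 1 D x by rewrite dilate1; apply: JA Jj _ _; exact: FA.
  by apply: le_dilate => //; rewrite le_max lexx.
have : dilate r D x by apply: FD; exists j.
by apply: le_dilate => //; [exact: ltW|rewrite le_max lexx orbT].
Qed.

Lemma Delta_b_infty_sub_Delta_infty : metrizable X -> schwartz_space X ->
  Delta_b_infty X `<=` Delta_infty X.
Proof.
move=> /metrizable_nbhs0_basis[A [A0 Abase]] XS xi xiD U UP.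
have [_ acU] := UP; have [V0 [V0P V0U V0pre]] := XS U UP.
apply: contrapT => noV.
have unbounded V (M : R) : zero_nbhds V ->
    exists n, (M%:E < `|xi n|%:E * delta n V U)%E.
  move=> VP; apply: contrapT => bnd; apply: noV; exists V; split => //.
  exists M => n; rewrite abse_scaled_width leNgt; apply/negP => Mn.
  by apply: bnd; exists n.
have /choice[nF nFP] : forall j : nat, exists nF : nat * set X,
    [/\ finite_set nF.2, nF.2 `<=` A j &
      (j%:R%:E < `|xi nF.1|%:E * delta nF.1 nF.2 U)%E].
  move=> j; have [V VP VA] := zero_nbhds_sub (A0 j).
  (* One starts from [j + 1] because passing to a finite net of radius [(|xi n| + 1)^-1] loses at
     most 1 after multiplication by [|xi n|]. *)
  have [n jn] := unbounded _ j.+1%:R (zero_nbhdsI V0P VP).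
  have eta0 : 0 < (`|xi n| + 1)^-1 by rewrite invr_gt0 ltr_wpDl.
  have [F [finF FV VF]] :=
    precompact_inner_net UP V0pre (@subIsetl _ V0 V) eta0.
  exists (n, F); split => //=; first by move=> x /FV[_ /VA].
  have := lt_le_trans jn (lee_wpmul2l _ (width_perturbation n acU eta0 VF)).
  rewrite lee_fin normr_ge0 => /(_ isT).
  rewrite ge0_muleDr ?width_ge0 ?lee_fin ?(ltW eta0)// => h.
  have {h} : (j.+1%:R%:E < `|xi n|%:E * delta n F U + 1)%E.
    apply: lt_le_trans h _; rewrite leeD2l// -EFinM lee_fin.
    by rewrite ler_pdivrMr ?ltr_wpDl// mul1r lerDl.
  by rewrite -natr1 EFinD lteD2rE.
have Bb : bounded_sets (\bigcup_j (nF j).2).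
  by apply: bounded_bigcup_null Abase _ _ => j; have [] := nFP j.
have [M xiM] := xiD U UP _ Bb.
(* This index exceeds the supposed bound [M]. *)
have [_ _ jn] := nFP (Num.truncn M).+1.
have := xiM (nF (Num.truncn M).+1).1.
rewrite abse_scaled_width leNgt => /negP; apply.
apply: lt_le_trans (_ : (Num.truncn M).+1%:R%:E <= _)%E.
  by rewrite lte_fin Num.Theory.truncnS_gt.
apply: le_trans (ltW jn) _; apply: lee_wpmul2l; first by rewrite lee_fin.
by apply: le_width => // x Fx; exists (Num.truncn M).+1.
Qed.

(** The common consequence of hilbertizability and of nuclearity from which [Delta_infty_sub_Delta]
    is derived. *)
Definition hilbertian_base : Prop := forall U, zero_nbhds U ->
  exists p, [/\ hilbertian p, nbhs (0 : X) [set x | p x < 1] &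
    [set x | p x < 1] `<=` U].

Lemma Delta_infty_sub_Delta : hilbertian_base -> schwartz_space X ->
  Delta_infty X `<=` Delta X.
Proof.
move=> XH XS xi xiD U UP; have [_ acU] := UP.
have [V0 [V0P V0U V0pre]] := XS U UP.
have [p [pH p0 pV0]] := XH V0 V0P.
set V := [set x | p x < 1] in p0 pV0.
have VP : zero_nbhds V by split => //; exact: hilbertian_ball_absolutely_convex.
have [_ acV] := VP.
(* [V2] makes radii below [d0] admissible for large [n], while [W0] keeps the products of [xi n] and
   the width bounded; their intersection [W] has both properties. *)
have [V2 [V2P _ V2pre]] := XS V VP.
have [W0 [W0P [M W0M]]] := xiD V VP.
have WP := zero_nbhdsI W0P V2P; set W := W0 `&` V2 in WP.
exists W; split => //; apply/cvge0P => e e0.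
have M0 : 0 < `|M| + 1 by rewrite ltr_wpDl.
have eM0 : 0 < e / (`|M| + 1) by rewrite divr_gt0.
have Vnet r : 0 < r -> exists2 F : set X, finite_set F &
    forall v, p v < 1 -> exists2 x, F x & dilate r U (v - x).
  move=> r0; have [F finF VF] := precompact_net UP V0pre r0; exists F => //.
  by move=> v /pV0 /VF.
have Wabs x : exists2 r, 0 < r & dilate r W x.
  by apply: nbhs0_absorbing; case: WP.
have [d0 d00 contract] :=
  contract_modulo_subspace UP pH (subset_trans pV0 V0U) Vnet Wabs eM0.
have d020 : 0 < d0 / 2 by rewrite divr_gt0.
apply: filterS (precompact_approximable VP V2pre d020) => n V2n.
have Wn : approximable n W V (d0 / 2).
  have [_ [L [Ln V2L]]] := V2n; split => //; exists L; split => //.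
  by apply: subset_trans V2L; exact: subIsetr.
have small d : d < d0 -> approximable n W V d ->
    approximable n W U (e / (`|M| + 1) * d).
  move=> dd0 [dpos [L [Ln WL]]]; split; first exact: mulr_gt0.
  exists L; split => //; rewrite mulrC; apply: contract => //.
  - by move=> x y; exact: (dim_at_mostD Ln).
  - by move=> t x; exact: (dim_at_mostZ _ Ln).
have h : (delta n W U <= (e / (`|M| + 1))%:E * delta n W V)%E.
  (* If [d >= d0], the radius [d0 / 2], admissible for this [n], is contracted instead and yields a
     smaller radius for [U]. *)
  apply: width_le_scale => // d Wd; have [dd0|d0d] := ltP d d0.
    exact: small.
  have : approximable n W U (e / (`|M| + 1) * (d0 / 2)).
    by apply: small => //; rewrite ltr_pdivrMr// ltr_pMr// ltr1n.
  apply: le_approximable => //; rewrite ler_pM2l//; lra.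
rewrite abse_scaled_width.
apply: le_trans (lee_wpmul2l _ h) _; first by rewrite lee_fin.
rewrite muleCA.
have xiW : (`|xi n|%:E * delta n W V <= (`|M| + 1)%:E)%E.
  have WW0 := le_width n (@subIsetl _ W0 V2) (@subset_refl _ V).
  apply: le_trans (lee_wpmul2l _ WW0) _; first by rewrite lee_fin.
  rewrite -abse_scaled_width; apply: le_trans (W0M n) _; rewrite lee_fin.
  by apply: le_trans (ler_norm M) _; rewrite lerDl.
apply: le_trans (lee_wpmul2l _ xiW) _; first by rewrite lee_fin ltW.
by rewrite -EFinM lee_fin divfK// gt_eqF.
Qed.

Lemma diametral_dimensions_eq : hilbertian_base -> metrizable X ->
  schwartz_space X ->
  [/\ Delta X = Delta_b X, Delta_b X = Delta_infty X &
      Delta_infty X = Delta_b_infty X].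
Proof.
move=> XH Xm XS.
have DB := Delta_sub_Delta_b; have BB := Delta_b_sub_Delta_b_infty.
have BD := Delta_b_infty_sub_Delta_infty Xm XS.
have DD := Delta_infty_sub_Delta XH XS.
split; apply/seteqP; split => x xD.
- exact: DB.
- exact: DD _ (BD _ (BB _ xD)).
- exact: BD _ (BB _ xD).
- exact: DB _ (DD _ xD).
- exact: BB _ (DB _ (DD _ xD)).
- exact: BD.
Qed.

End Diametral.

(** * Constructing hilbertian seminorms: scalar products, sums and limits *)

Section HilbertianConstructions.
Context {R : realType} {k : scalar_kind} {X : tvsType (scalars R k)}.
Local Notation K := (scalars R k).
Local Notation ofR := (of_real (R := R) k).
Implicit Types (x y z : X) (s t : R) (p : X -> R).

Lemma hilbertian_sqrt (Q : X -> R) (b : X -> X -> R) :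
  real_inner_product b -> (forall x, b x x = Q x) ->
  (forall a x, Q (a *: x) = modulus a ^+ 2 * Q x) ->
  hilbertian (fun x => Num.sqrt (Q x)).
Proof.
move=> bP bQ QZ; have [_ _ _ b0] := bP; split => [x|a x|].
- exact: sqrtr_ge0.
- by rewrite QZ sqrtrM ?sqr_ge0// sqrtr_sqr ger0_norm// modulus_ge0.
- by exists b => // x; rewrite sqr_sqrtr// -bQ.
Qed.

Lemma semi_scalar_product_hilbertian p (s : X -> X -> K) :
  semi_scalar_product s -> seminorm_induced_by p s -> hilbertian p.
Proof.
move=> [sD sC s0] ps.
have sz0 z : s 0 z = 0.
  have := sD 1 0 0 z; rewrite scaler0 addr0 mul1r -{1}[s 0 z]addr0.
  by move=> /addrI <-.
have sZ a x z : s (a *: x) z = a * s x z.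
  by have := sD a x 0 z; rewrite sz0 !addr0.
split=> [x|a x|]; first exact: (ps x).1.
- apply/eqP; rewrite -(@eqrXn2 _ 2)// ?mulr_ge0 ?modulus_ge0 ?(ps _).1//.
  apply/eqP/(@of_real_inj R k); rewrite (ps _).2 sZ sC sZ scalar_conjM -sC.
  by rewrite mulrA mul_scalar_conj -(ps x).2 -rmorphM /= exprMn.
- exists (fun x y => re_part (s x y)) => [|x]; last first.
    by rewrite -(ps x).2 re_part_of_real.
  split=> [x y|x y z|t x y|x].
  + by rewrite sC re_part_conj.
  + by have := sD 1 x y z; rewrite scale1r mul1r => ->; rewrite re_partD.
  + by rewrite sZ re_partZ.
  + by rewrite -(ps x).2 re_part_of_real sqr_ge0.
Qed.

Lemma hilbertian_modulus (f : {linear X -> K^o}) :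
  hilbertian (fun x => modulus (f x)).
Proof.
pose s x y : K := (f x : K) * scalar_conj k (f y : K).
apply: (@semi_scalar_product_hilbertian _ s).
  split=> [a x y z|x y|x].
  - by rewrite /s linearP /= mulrDl mulrA.
  - rewrite /s scalar_conjM [RHS]mulrC; congr (_ * _).
    by move: (f y : K); case: k => //= a; rewrite conjcK.
  - by rewrite /s mul_scalar_conj -(rmorph0 ofR) ler_of_real sqr_ge0.
by move=> x; split; [exact: modulus_ge0|rewrite /s mul_scalar_conj].
Qed.

Lemma hilbertian_weighted_sum n (w : nat -> R) (p : nat -> X -> R) :
  (forall i, 0 <= w i) -> (forall i, hilbertian (p i)) ->
  exists2 b, real_inner_product b &
    forall x, b x x = \sum_(i < n) w i * p i x ^+ 2.
Proof.
move=> w0 pH.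
have /choice[b bP] : forall i, exists b,
    real_inner_product b /\ forall x, b x x = p i x ^+ 2.
  by move=> i; have [_ _ [b bP bE]] := pH i; exists b.
exists (fun x y => \sum_(i < n) w i * b i x y).
  split=> [x y|x y z|t x y|x].
  - by apply: eq_bigr => i _; have [[-> _ _ _] _] := bP i.
  - rewrite -big_split; apply: eq_bigr => i _.
    by have [[_ -> _ _] _] := bP i; rewrite mulrDr.
  - rewrite mulr_sumr; apply: eq_bigr => i _.
    by have [[_ _ -> _] _] := bP i; rewrite mulrCA.
  - by apply: sumr_ge0 => i _; have [[_ _ _ h] _] := bP i; rewrite mulr_ge0.
by move=> x; apply: eq_bigr => i _; have [_ ->] := bP i.
Qed.

Lemma weighted_sumZ n (w : nat -> R) (p : nat -> X -> R) a x :
  (forall i, hilbertian (p i)) ->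
  \sum_(i < n) w i * p i (a *: x) ^+ 2 =
  modulus a ^+ 2 * \sum_(i < n) w i * p i x ^+ 2.
Proof.
move=> pH; rewrite mulr_sumr; apply: eq_bigr => i _.
by have [_ -> _] := pH i; rewrite exprMn mulrCA.
Qed.

(* The inner products converge with the quadratic forms, by polarization. *)
Lemma hilbertian_limit (Q : nat -> X -> R) (q : X -> R) :
  (forall n, exists2 b, real_inner_product b & forall x, b x x = Q n x) ->
  (forall n a x, Q n (a *: x) = modulus a ^+ 2 * Q n x) ->
  (forall x, Q n x @[n --> \oo] --> q x) ->
  hilbertian (fun x => Num.sqrt (q x)).
Proof.
move=> Qb QZ Qq.
have /choice[b bP] : forall n, exists b,
    real_inner_product b /\ forall x, b x x = Q n x.
  by move=> n; have [b bP bE] := Qb n; exists b.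
pose B x y := (q (x + y) - q (x - y)) / 4.
have bE n x y : b n x y = (Q n (x + y) - Q n (x - y)) / 4.
  have [[bC bD bZ _] bQ] := bP n; rewrite -!bQ.
  have bDr u v w : b n u (v + w) = b n u v + b n u w.
    by rewrite bC bD ![b n _ u]bC.
  have bN u v : b n (- u) v = - b n u v.
    by rewrite -scaleN1r -(rmorph1 ofR) -rmorphN bZ mulN1r.
  have bNr u v : b n u (- v) = - b n u v by rewrite bC bN bC.
  by rewrite !bD !bDr !bN !bNr (bC y x); field.
have bB x y : b n x y @[n --> \oo] --> B x y.
  under eq_fun do rewrite bE.
  by apply: cvgMl; apply: cvgB.
apply: (@hilbertian_sqrt q B).
- split=> [x y|x y z|t x y|x].
  + apply: cvg_unique (bB x y) _ => //.
    have -> : (fun n => b n x y) = (fun n => b n y x); last exact: bB.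
    by apply/funext => n; have [[-> _ _ _] _] := bP n.
  + apply: cvg_unique (bB (x + y) z) _ => //.
    have -> : (fun n => b n (x + y) z) = (fun n => b n x z + b n y z).
      by apply/funext => n; have [[_ -> _ _] _] := bP n.
    by apply: cvgD; exact: bB.
  + apply: cvg_unique (bB (ofR t *: x) y) _ => //.
    have -> : (fun n => b n (ofR t *: x) y) = (fun n => t * b n x y).
      by apply/funext => n; have [[_ _ -> _] _] := bP n.
    by apply: cvgMr; exact: bB.
  + rewrite -(cvg_lim _ (bB x x))//; apply: limr_ge; first exact: cvgP (bB x x).
    by apply: nearW => n; have [[_ _ _ ->]] := bP n.
- move=> x; apply: cvg_unique (bB x x) _ => //.
  have -> : (fun n => b n x x) = (fun n => Q n x); last exact: Qq.
  by apply/funext => n; have [_ ->] := bP n.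
- move=> a x; apply: cvg_unique (Qq (a *: x)) _ => //.
  have -> : (fun n => Q n (a *: x)) = (fun n => modulus a ^+ 2 * Q n x).
    by apply/funext => n.
  by apply: cvgMr; exact: Qq.
Qed.

End HilbertianConstructions.

(** * Hilbertizable spaces have a base of hilbertian balls *)

Section Hilbertizable.
Context {R : realType} {k : scalar_kind} (X : tvsType (scalars R k)).

(** A neighbourhood is controlled by finitely many seminorms and one [e]; the root of the sum of
    their squares divided by [e ^+ 2] is a single hilbertian seminorm dominating each of them over
    [e]. *)
Lemma hilbertizable_base : hilbertizable X -> hilbertian_base X.
Proof.
move=> [P [Ptop PH]] U [U0 _].
have [F [finF FP [e [e0 eU]]]] := (Ptop 0 U).1 U0.
have Pnbhs p t : P p -> 0 < t -> nbhs (0 : X) [set x | p x < t].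
  move=> Pp t0; apply/Ptop; exists [set p]; split => //; first by move=> _ ->.
  by exists t; split => // y /(_ p erefl); rewrite subr0.
have Philb p : P p -> hilbertian p.
  by move=> /PH[s [sP ps]]; exact: semi_scalar_product_hilbertian ps.
(* The classical equality on functions allows the family to be listed. *)
have /finite_seqP[s sE] : finite_set (F : set {classic (X -> R)}) by [].
pose p i : X -> R := nth (fun=> 0) s i.
have pP i : (i < size s)%N -> F (p i).
  by move=> si; have : [set` s] (p i) := mem_nth _ si; rewrite -sE.
have pH i : hilbertian (p i).
  (* Indices beyond the list give the zero seminorm. *)
  have [si|si] := ltnP i (size s); first exact/Philb/FP/pP.
  rewrite /p nth_default//; split => [//|a x|]; first by rewrite mulr0.
  exists (fun _ _ => 0) => [|x]; last by rewrite expr0n.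
  by split=> * //; rewrite ?addr0 ?mulr0.
have w0 : 0 <= e ^- 2 by rewrite invr_ge0 exprn_ge0// ltW.
have [b bP bE] := hilbertian_weighted_sum (size s) (fun=> w0) pH.
exists (fun x => Num.sqrt (\sum_(i < size s) e ^- 2 * p i x ^+ 2)); split.
- apply: hilbertian_sqrt bP bE _ => a x.
  exact: (weighted_sumZ _ (fun=> e ^- 2) a x pH).
(* With [m] seminorms below [e / (m + 1)], each term is at most [1 / (m + 1)] and the sum stays
   below 1, also for [m = 0]. *)
- have n0 : 0 < e / (size s).+1%:R by rewrite divr_gt0.
  have : \forall x \near (0 : X),
      forall i : 'I_(size s), p i x < e / (size s).+1%:R.
    by apply: filter_forall => i; apply: Pnbhs => //; exact/FP/pP.
  apply: filterS => x px /=; rewrite -[ltRHS]sqrtr1 ltr_sqrt//.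
  apply: (@le_lt_trans _ _ (\sum_(i < size s) (size s).+1%:R^-1)); last first.
    rewrite sumr_const card_ord -[ltLHS]mulr_natr mulrC ltr_pdivrMr// mul1r.
    by rewrite ltr_nat.
  apply: ler_sum => i _; rewrite mulrC ler_pdivrMr ?exprn_gt0//.
  have [pi0 _ _] := pH i.
  apply: (@le_trans _ _ ((e / (size s).+1%:R) ^+ 2)).
    by rewrite ler_pXn2r ?nnegrE ?(ltW n0)//; exact: ltW.
  rewrite exprMn mulrC ler_pM2r ?exprn_gt0// expr2 ler_piMl ?invr_ge0//.
  by rewrite invf_le1// ler1n.
- move=> x /=; rewrite -[ltRHS]sqrtr1 ltr_sqrt// => Q1; apply: eU => q Fq /=.
  have : [set` s] q by rewrite -sE.
  rewrite subr0 /= => qs; have qi : (index q s < size s)%N by rewrite index_mem.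
  have -> : q = p (index q s) by rewrite /p nth_index.
  have [pi0 _ _] := pH (index q s).
  rewrite -(@ltr_pXn2r _ 2)// ?nnegrE ?(ltW e0)//.
  rewrite -[ltRHS]mul1r -ltr_pdivrMr ?exprn_gt0// mulrC.
  apply: le_lt_trans Q1; rewrite (bigD1 (Ordinal qi))//= lerDl.
  by apply: sumr_ge0 => i _; rewrite mulr_ge0// sqr_ge0.
Qed.

End Hilbertizable.

(** * Finite nets in discs of scalars *)

Section ScalarNet.
Context {R : realType}.

Lemma real_interval_net (c e : R) : 0 < e ->
  exists2 G : set R, finite_set G &
    forall r, `|r| <= c -> exists2 g, G g & `|r - g| <= e.
Proof.
(* A grid of step [e] starting at [- c]; the truncation of [(r + c) / e] indexes the grid point just
   below [r]. *)
move=> e0; exists [set j%:R * e - c | j in `I_(Num.truncn (c *+ 2 / e)).+1].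
  exact: finite_image.
move=> r; rewrite ler_norml => /andP[cr rc].
have rc0 : 0 <= (r + c) / e by rewrite divr_ge0 ?(ltW e0)//; lra.
set t := Num.truncn ((r + c) / e); exists (t%:R * e - c).
  exists t => //=; rewrite ltnS; apply: le_truncn.
  by rewrite ler_pM2r ?invr_gt0//; lra.
have /andP[] := truncn_itv rc0; rewrite -/t; move: t => t.
rewrite ler_pdivlMr// ltr_pdivrMr// -natr1 mulrDl mul1r => h1 h2.
by rewrite ler_norml; apply/andP; split; lra.
Qed.

Lemma scalar_net (k : scalar_kind) (c e : R) : 0 < e ->
  exists2 G : set (scalars R k), finite_set G &
    forall a, modulus a <= c -> exists2 g, G g & modulus (a - g) <= e.
Proof.
move=> e0.
have modE (a : scalars R k) (t : R) : (modulus a <= t) = (`|a| <= of_real k t).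
  by rewrite modulusE ler_of_real.
have [H finH Hnet] := real_interval_net c (divr_gt0 e0 (ltr0n R 2)).
have e2 : e / 2 <= e by rewrite ler_pdivrMr// ler_pMr// ler1n.
case: k modE => modE.
  exists H => // a; rewrite modE /= => /Hnet[g Hg ag]; exists g => //.
  by rewrite modE /=; exact: le_trans e2.
(* Errors of [e / 2] in both coordinates give a modulus of at most [e / sqrt 2]. *)
exists [set (z.1 +i* z.2)%C | z in H `*` H].
  by apply: finite_image; exact: finite_setX.
move=> [x y]; rewrite modE /= normc_def /= lecR => xyc.
have xc : `|x| <= c.
  by apply: le_trans xyc; rewrite -sqrtr_sqr ler_wsqrtr// lerDl sqr_ge0.
have yc : `|y| <= c.
  by apply: le_trans xyc; rewrite -sqrtr_sqr ler_wsqrtr// lerDr sqr_ge0.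
have [g Hg xg] := Hnet x xc; have [h Hh yh] := Hnet y yc.
exists (g +i* h)%C; first by exists (g, h).
rewrite modE /= normc_def lecR /=.
have sqr_le u : `|u| <= e / 2 -> u ^+ 2 <= (e / 2) ^+ 2.
  move=> ue; rewrite -real_normK ?num_real//.
  by rewrite ler_pXn2r ?nnegrE// divr_ge0// ltW.
rewrite -[leRHS](gtr0_norm e0) -sqrtr_sqr ler_wsqrtr//.
have := sqr_le _ xg; have := sqr_le _ yh; have := sqr_ge0 e.
by rewrite exprMn; lra.
Qed.

End ScalarNet.

(** * Nuclear canonical maps: a hilbertian ball and precompactness *)

Section Nuclear.
Context {R : realType} {k : scalar_kind} (X : tvsType (scalars R k)).
Local Notation K := (scalars R k).
Local Notation ofR := (of_real (R := R) k).
Local Notation gauge := minkowski_functional.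
Variables (U V : set X).
Variables (f : nat -> {linear X -> K^o}) (y : nat -> X) (c : nat -> R).
Hypotheses (UP : zero_nbhds U) (VP : zero_nbhds V).
Hypotheses (c0 : forall n, 0 <= c n).
Hypothesis fc : forall n x, `|f n x| <= ofR (c n * gauge V x) :> K.
Hypothesis cy : cvgn (series (fun n => c n * gauge U (y n))).
Hypothesis fy : forall x,
  gauge U (x - \sum_(i < n) (f i x : K) *: y i) @[n --> \oo] --> (0 : R).

Let a i := c i * gauge U (y i).

Let a_ge0 i : 0 <= a i.
Proof. by rewrite mulr_ge0 ?gauge_ge0. Qed.

Let m i x := modulus (f i x : K).

Let m_le i x : m i x <= c i * gauge V x.
Proof. by have := fc i x; rewrite modulusE ler_of_real. Qed.

(** A tail estimate without infinite sums: [n] is taken so large that the first summand is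
    negligible. The case [N = 0] bounds the gauge of [x]; a large [N] serves for precompactness. *)
Lemma nuclear_gauge_le x (N n : nat) : (N <= n)%N ->
  gauge U (x - \sum_(i < N) (f i x : K) *: y i) <=
  gauge U (x - \sum_(i < n) (f i x : K) *: y i) +
  \sum_(N <= i < n) m i x * gauge U (y i).
Proof.
elim: n => [|n IH]; first by rewrite leqn0 => /eqP->; rewrite big_geq// addr0.
rewrite leq_eqVlt => /orP[/eqP->|Nn]; first by rewrite big_geq// addr0.
apply: le_trans (IH Nn) _; rewrite big_nat_recr//= addrA addrAC lerD2r.
set S := \sum_(i < n) _; rewrite big_ord_recr /= -/S.
have -> : x - S = (x - (S + (f n x : K) *: y n)) + (f n x : K) *: y n.
  by rewrite opprD addrA subrK.
by apply: le_trans (gaugeD UP _ _) _; rewrite lerD2l; exact: gaugeZ.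
Qed.

Let C := limn (series a).

Let series_le n : series a n <= C.
Proof.
apply: nondecreasing_cvgn_le => //.
by apply: nondecreasing_series => i _ _; exact: a_ge0.
Qed.

Let C_ge0 : 0 <= C.
Proof. by have := series_le 0; rewrite /series /= big_geq. Qed.

(** Dividing by [c i] makes [w i * m i x ^+ 2] at most [(C + 1) * a i * gauge V x ^+ 2], which is
    summable; the factor [C + 1] makes the remaining terms [a i / (C + 1)] sum to at most 1. If
    [c i = 0], the weight is 0 and [f i] vanishes. *)
Let w i := (C + 1) * (gauge U (y i) / c i).

Let w_ge0 i : 0 <= w i.
Proof. by rewrite mulr_ge0 ?addr_ge0// divr_ge0// gauge_ge0. Qed.

Let Q n x := \sum_(i < n) w i * m i x ^+ 2.

Let Q_le n x : Q n x <= (C + 1) * C * gauge V x ^+ 2.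
Proof.
have C1 : 0 <= C + 1 by rewrite addr_ge0.
apply: le_trans (_ : (C + 1) * series a n * gauge V x ^+ 2 <= _); last first.
  by rewrite ler_wpM2r ?sqr_ge0// ler_wpM2l.
rewrite /series /= big_mkord mulr_sumr mulr_suml; apply: ler_sum => i _.
rewrite /w /a -!mulrA ler_wpM2l//.
have [ci0|ci_neq0] := eqVneq (c i) 0.
  by rewrite ci0 invr0 !mul0r mulr0.
have -> : c i * (gauge U (y i) * gauge V x ^+ 2) =
    gauge U (y i) * ((c i)^-1 * (c i * gauge V x) ^+ 2) by field.
rewrite ler_wpM2l ?gauge_ge0// ler_wpM2l ?invr_ge0//.
by rewrite ler_pXn2r ?nnegrE ?mulr_ge0 ?modulus_ge0 ?gauge_ge0.
Qed.

Let Q_cvg x : cvgn (Q ^~ x).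
Proof.
apply: nondecreasing_is_cvgn; last first.
  by exists ((C + 1) * C * gauge V x ^+ 2) => _ [n _ <-]; exact: Q_le.
apply/nondecreasing_seqP => n; rewrite /Q big_ord_recr /= lerDl.
by rewrite mulr_ge0// sqr_ge0.
Qed.

Let q x := limn (Q ^~ x).

Let Q_le_q n x : Q n x <= q x.
Proof.
apply: (@nondecreasing_cvgn_le _ (Q ^~ x)) => //.
apply/nondecreasing_seqP => j; rewrite /Q big_ord_recr /= lerDl.
by rewrite mulr_ge0// sqr_ge0.
Qed.

(* AM-GM: [2 m u <= (C + 1) (u / c) m ^ 2 + c u / (C + 1)] *)
Let term_le i x :
  (m i x * gauge U (y i)) *+ 2 <= w i * m i x ^+ 2 + a i / (C + 1).
Proof.
have C1 : 0 < C + 1 by rewrite ltr_wpDl.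
have [ci0|ci_neq0] := eqVneq (c i) 0.
  have -> : m i x = 0.
    apply/eqP; rewrite eq_le modulus_ge0 andbT.
    by have := m_le i x; rewrite ci0 mul0r.
  by rewrite mul0r mul0rn expr0n mulr0 add0r divr_ge0 ?(ltW C1).
have ci : 0 < c i by rewrite lt_neqAle eq_sym ci_neq0 c0.
rewrite -subr_ge0.
have -> : w i * m i x ^+ 2 + a i / (C + 1) - (m i x * gauge U (y i)) *+ 2 =
    gauge U (y i) * (((C + 1) * m i x - c i) ^+ 2 / ((C + 1) * c i)).
  by rewrite /w /a; field; rewrite !gt_eqF.
by rewrite mulr_ge0 ?gauge_ge0// divr_ge0 ?sqr_ge0// mulr_ge0// ltW.
Qed.

(** Sum [term_le] over an initial segment after which the remainder of [x] is small. The point of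
    the bound is that [q x < 1] forces [gauge U x < 1]. *)
Let gauge_le_q x : (gauge U x) *+ 2 <= q x + 1.
Proof.
have C1 : 0 < C + 1 by rewrite ltr_wpDl.
apply/ler_addgt0Pr => e e0.
have e20 : 0 < e / 2 by rewrite divr_gt0.
have /cvgrPdist_lt/(_ _ e20)[N _ /(_ N (leqnn N))] := fy x.
rewrite /= sub0r normrN ger0_norm ?gauge_ge0// => xN.
have := nuclear_gauge_le x (leq0n N); rewrite big_ord0 subr0 big_mkord => h.
have : (\sum_(i < N) m i x * gauge U (y i)) *+ 2 <=
    Q N x + series a N / (C + 1).
  rewrite -sumrMnl /series /= big_mkord mulr_suml -big_split.
  by apply: ler_sum => i _; exact: term_le.
have : series a N / (C + 1) <= 1.
  rewrite ler_pdivrMr// mul1r.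
  by apply: le_trans (series_le N) _; rewrite lerDl.
by have := Q_le_q N x; lra.
Qed.

Lemma nuclear_hilbertian : exists p, [/\ hilbertian p,
  nbhs (0 : X) [set x | p x < 1] & [set x | p x < 1] `<=` U].
Proof.
have mH i : hilbertian (m i) by exact: hilbertian_modulus.
exists (fun x => Num.sqrt (q x)); split.
- apply: (@hilbertian_limit _ _ _ Q) => [n|n b x|x].
  + exact: hilbertian_weighted_sum.
  + exact: weighted_sumZ.
  + exact: Q_cvg.
- have C1 : 0 < C + 1 by rewrite ltr_wpDl.
  have t0 : 0 < (C + 1)^-1 by rewrite invr_gt0.
  (* On [V] shrunk by [C + 1], [q] is at most [C / (C + 1)]. *)
  apply: filterS (nbhs0_dilate t0 (proj1 VP)) => x /(gauge_le VP t0) xt.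
  rewrite /= -[ltRHS]sqrtr1 ltr_sqrt//.
  apply: (@le_lt_trans _ _ ((C + 1) * C * gauge V x ^+ 2)).
    by apply: limr_le; [exact: Q_cvg|exact: nearW].
  apply: (@le_lt_trans _ _ ((C + 1) * C * (C + 1)^-1 ^+ 2)).
    rewrite ler_wpM2l ?mulr_ge0 ?(ltW C1)//.
    by rewrite ler_pXn2r ?nnegrE ?gauge_ge0// ltW.
  have -> : (C + 1) * C * (C + 1)^-1 ^+ 2 = C / (C + 1).
    by field; rewrite gt_eqF.
  by rewrite ltr_pdivrMr// mul1r ltrDl.
- move=> x /=; rewrite -[ltRHS]sqrtr1 ltr_sqrt// => qx.
  rewrite -(dilate1 U); apply: (gauge_lt UP).
  by have := gauge_le_q x; lra.
Qed.

Lemma precompact_box N (e : R) : 0 < e -> exists2 F : set X, finite_set F &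
  forall b : nat -> K, (forall i, modulus (b i) <= c i) ->
    exists2 x, F x & gauge U (\sum_(i < N) b i *: y i - x) < e.
Proof.
elim: N e => [|N IH] e e0.
  exists [set 0] => // b _; exists 0 => //; rewrite big_ord0 subr0.
  have := gaugeZ UP 0 0; rewrite scale0r modulus0 mul0r.
  by move=> /le_lt_trans; apply.
have e20 : 0 < e / 2 by rewrite divr_gt0.
have u0 : 0 < gauge U (y N) + 1 by rewrite ltr_wpDl ?gauge_ge0.
have [F finF FN] := IH _ e20.
(* With this precision the last coordinate contributes at most [e / 2]. *)
have [G finG GN] := @scalar_net R k (c N) _ (divr_gt0 e20 u0).
exists [set z.1 + z.2 *: y N | z in F `*` G].
  by apply: finite_image; exact: finite_setX.
move=> b bc; have [x Fx bx] := FN b bc; have [g Gg bg] := GN _ (bc N).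
exists (x + g *: y N); first by exists (x, g).
have -> : \sum_(i < N.+1) b i *: y i - (x + g *: y N) =
    (\sum_(i < N) b i *: y i - x) + (b N - g) *: y N.
  by rewrite big_ord_recr /= opprD addrACA -scalerBl.
apply: le_lt_trans (gaugeD UP _ _) _.
have -> : e = e / 2 + e / 2 by field.
apply: ltr_leD => //; apply: le_trans (gaugeZ UP _ _) _.
apply: le_trans (ler_wpM2r (gauge_ge0 UP _) bg) _.
by rewrite mulrAC ler_pdivrMr// ler_wpM2l ?(ltW e20)// lerDl.
Qed.

(** On [V] the coefficients are bounded by [c i], so partial sums of length [N] lie in a precompact
    box, and the tails are small uniformly in [v] by convergence of the series [cy]. *)
Lemma nuclear_precompact : precompact_wrt (gauge U) V.
Proof.
move=> e e0; have e30 : 0 < e / 3 by rewrite divr_gt0.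
have /cvgrPdist_lt/(_ _ e30)[N _ Ntail] := cy.
have [F finF FN] := precompact_box N e30.
exists F; split => // v Vv.
have gv : gauge V v <= 1 by apply: gauge_le => //; rewrite dilate1.
have mc i : m i v <= c i.
  by apply: le_trans (m_le i v) _; rewrite ler_piMr.
have [x Fx vx] := FN (fun i => f i v) mc.
exists x; split => //.
(* This [n] depends on [v], unlike [N]; the terms between the two are bounded by the tail of the
   series. *)
have [n Nn vn] : exists2 n, (N <= n)%N &
    gauge U (v - \sum_(i < n) (f i v : K) *: y i) < e / 3.
  have /cvgrPdist_lt/(_ _ e30)[n1 _ h1] := fy v.
  exists (maxn N n1); first exact: leq_maxl.
  have := h1 _ (leq_maxr N n1).
  by rewrite /= sub0r normrN ger0_norm ?gauge_ge0.
have tail : \sum_(N <= i < n) m i v * gauge U (y i) < e / 3.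
  apply: (@le_lt_trans _ _ (series a n - series a N)).
    rewrite sub_series Nn; apply: ler_sum => i _.
    by rewrite ler_wpM2r ?gauge_ge0.
  apply: (@le_lt_trans _ _ (C - series a N)); first by rewrite lerD2r.
  by have := Ntail N (leqnn N); rewrite /=; exact/le_lt_trans/ler_norm.
have -> : v - x = (v - \sum_(i < N) (f i v : K) *: y i) +
    (\sum_(i < N) (f i v : K) *: y i - x) by rewrite addrA subrK.
apply: le_lt_trans (gaugeD UP _ _) _.
by have := nuclear_gauge_le v Nn; lra.
Qed.

End Nuclear.

(** * Nuclear spaces, and the equality of the four sets *)

Section NuclearSpace.
Context {R : realType} {k : scalar_kind} (X : tvsType (scalars R k)).

Lemma nuclear_schwartz : nuclear_space X -> schwartz_space X.
Proof.
move=> XN U UP; have [V [VP VU [f [y [c [c0 fc cy fy]]]]]] := XN U UP.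
by exists V; split => //; exact: nuclear_precompact fc cy fy.
Qed.

Lemma nuclear_hilbertian_base : nuclear_space X -> hilbertian_base X.
Proof.
move=> XN U UP; have [V [VP VU [f [y [c [c0 fc cy fy]]]]]] := XN U UP.
exact: nuclear_hilbertian UP VP c0 fc cy fy.
Qed.

End NuclearSpace.

Theorem theorem1p4 (R : realType) (k : scalar_kind)
    (X : tvsType (scalars R k)) :
  (hilbertizable X -> frechet_space X -> schwartz_space X ->
     [/\ Delta X = Delta_b X,
         Delta_b X = Delta_infty X &
         Delta_infty X = Delta_b_infty X]) /\
  (nuclear_space X -> frechet_space X ->
     [/\ Delta X = Delta_b X,
         Delta_b X = Delta_infty X &
         Delta_infty X = Delta_b_infty X]).
Proof.
split=> [XH [Xm _] XS|XN [Xm _]].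
  by apply: diametral_dimensions_eq => //; exact: hilbertizable_base.
apply: diametral_dimensions_eq => //; first exact: nuclear_hilbertian_base.
exact: nuclear_schwartz.
Qed.
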